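(* Let $\alpha,\beta>-1$ be real, $c$ real with $c\neq\pm1$, and let $P_n^{(-1)}$ be the monic big $-1$ Jacobi polynomials with parameters $\alpha,\beta,c$. Put $z=\dfrac{1-x^2}{1-c^2}$. If $n\ge0$ is even, then $$P_n^{(-1)}(x)=\kappa_n\left[{}_2F_1\!\left(-\tfrac n2,\tfrac{n+\alpha+\beta+2}{2};\tfrac{\alpha+1}{2};z\right)+\frac{n(1-x)}{(1+c)(\alpha+1)}\,{}_2F_1\!\left(1-\tfrac n2,\tfrac{n+\alpha+\beta+2}{2};\tfrac{\alpha+3}{2};z\right)\right],$$ and if $n\ge1$ is odd, then $$P_n^{(-1)}(x)=\kappa_n\left[{}_2F_1\!\left(-\tfrac{n-1}2,\tfrac{n+\alpha+\beta+1}{2};\tfrac{\alpha+1}{2};z\right)-\frac{(\alpha+\beta+n+1)(1-x)}{(1+c)(\alpha+1)}\,{}_2F_1\!\left(-\tfrac{n-1}2,\tfrac{n+\alpha+\beta+3}{2};\tfrac{\alpha+3}{2};z\right)\right],$$ where $$\kappa_n=\begin{cases}\dfrac{(1-c^2)^{n/2}\left(\frac{\alpha+1}{2}\right)_{n/2}}{\left(\frac{n+\alpha+\beta+2}{2}\right)_{n/2}},& n\text{ even},\\[4mm](1+c)\dfrac{(1-c^2)^{(n-1)/2}\left(\frac{\alpha+1}{2}\right)_{(n+1)/2}}{\left(\frac{n+\alpha+\beta+1}{2}\right)_{(n+1)/2}},& n\text{ odd}.\end{cases}$$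
   Context: $(t)_k=t(t+1)\cdots(t+k-1)$ is the Pochhammer symbol and ${}_2F_1$ is Gauss' hypergeometric series (terminating here; for $n=0$ the second term in the even formula is $0$ because of the factor $n$). The monic big $-1$ Jacobi polynomials $P_n^{(-1)}(x)$ with parameters $\alpha,\beta,c$ are defined by $P_{-1}^{(-1)}=0$, $P_0^{(-1)}=1$ and $$P_{n+1}^{(-1)}(x)+b_n^{(-1)}P_n^{(-1)}(x)+u_n^{(-1)}P_{n-1}^{(-1)}(x)=xP_n^{(-1)}(x),\quad u_n^{(-1)}=A_{n-1}C_n,\quad b_n^{(-1)}=1-A_n-C_n,$$ where $$A_n=\begin{cases}\frac{(c+1)(\alpha+n+1)}{\alpha+\beta+2n+2},& n\text{ even},\\ \frac{(1-c)(\alpha+\beta+n+1)}{\alpha+\beta+2n+2},& n\text{ odd},\end{cases}\qquad C_n=\begin{cases}\frac{(1-c)n}{\alpha+\beta+2n},& n\text{ even},\\ \frac{(1+c)(\beta+n)}{\alpha+\beta+2n},& n\text{ odd},\end{cases}$$ with $C_0=0$. (They are the limits of the monic big $q$-Jacobi polynomials $P_n(x;a,b,c)$ for $q=-e^{\epsilon}$, $a=-e^{\epsilon\alpha}$, $b=-e^{\epsilon\beta}$, $\epsilon\to0$.) *)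

(* Defs.v *)
From HB Require Import structures.
From mathcomp Require Import all_boot all_order all_algebra.
From mathcomp Require Import all_classical all_reals all_analysis.

Set Implicit Arguments.
Unset Strict Implicit.
Unset Printing Implicit Defensive.

Import Order.TTheory GRing.Theory Num.Theory.
Import numFieldNormedType.Exports.

Local Open Scope ring_scope.

Definition pochhammer (R : realType) (t : R) (k : nat) : R :=
  \prod_(i < k) (t + i%:R).

(* The sum of Gauss' series, as the limit of its partial sums; no convergence
   is built in, so the value is meaningful only where the series converges
   (in particular where it terminates). *)
Definition hyp2F1 (R : realType) (a b c z : R) : R :=
  limn (series (fun k : nat =>
    pochhammer a k * pochhammer b k / (pochhammer c k * k`!%:R) * z ^+ k)).

Definition jacobiA (R : realType) (alpha beta c : R) (n : nat) : R :=
  if odd n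
  then (1 - c) * (alpha + beta + n%:R + 1) / (alpha + beta + 2 * n%:R + 2)
  else (c + 1) * (alpha + n%:R + 1) / (alpha + beta + 2 * n%:R + 2).

(* The value at n = 0 is 0 for all alpha and beta, including
   alpha + beta = 0, since 0 / 0 = 0 here. *)
Definition jacobiC (R : realType) (alpha beta c : R) (n : nat) : R :=
  if odd n
  then (1 + c) * (beta + n%:R) / (alpha + beta + 2 * n%:R)
  else (1 - c) * n%:R / (alpha + beta + 2 * n%:R).

(* u_0 = A_(-1) C_0 = 0: the truncation of n.-1 at n = 0 is harmless, as
   C_0 = 0. *)
Definition jacobi_u (R : realType) (alpha beta c : R) (n : nat) : R :=
  jacobiA alpha beta c n.-1 * jacobiC alpha beta c n.

Definition jacobi_b (R : realType) (alpha beta c : R) (n : nat) : R :=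
  1 - jacobiA alpha beta c n - jacobiC alpha beta c n.

(* The recurrence P_(m+1) + b_m P_m + u_m P_(m-1) = X P_m solved for P_(m+1);
   the inner 0 is P_(-1). *)
Fixpoint bigm1_jacobi (R : realType) (alpha beta c : R) (n : nat) : {poly R} :=
  if n is m.+1 then
    'X * bigm1_jacobi alpha beta c m
    - jacobi_b alpha beta c m *: bigm1_jacobi alpha beta c m
    - jacobi_u alpha beta c m *:
        (if m is k.+1 then bigm1_jacobi alpha beta c k else 0)
  else 1.

Definition jacobi_kappa (R : realType) (alpha beta c : R) (n : nat) : R :=
  if odd n
  then (1 + c) * ((1 - c ^+ 2) ^+ n.-1./2 *
         pochhammer ((alpha + 1) / 2) n.+1./2 /
         pochhammer ((n%:R + alpha + beta + 1) / 2) n.+1./2)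
  else (1 - c ^+ 2) ^+ n./2 *
         pochhammer ((alpha + 1) / 2) n./2 /
         pochhammer ((n%:R + alpha + beta + 2) / 2) n./2.

(* Main.v *)
Require Import Defs.
From HB Require Import structures.
From mathcomp Require Import all_boot all_order all_algebra.
From mathcomp Require Import all_classical all_reals all_analysis.
From mathcomp Require Import ring lra.

Import Order.TTheory GRing.Theory Num.Theory.
Import numFieldNormedType.Exports.

Local Open Scope ring_scope.

(** Let P_n denote the polynomials and w = 1 - x.  At x = 1 the recurrence
reduces to P_(n+1)(1) = A_n P_n(1), so P_n(1) = A_0 ... A_(n-1), and this
product is kappa_n ([jacobi_kappaE]).  Hence one may write P_n = kappa_n p_n
with p_n(1) = 1; as b_n = 1 - A_n - C_n, the recurrence becomes the
difference equation
<<
   A_n (p_(n+1) - p_n) - C_n (p_n - p_(n-1)) = - w p_n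
>>
([horner_bigm1_jacobi]), and it remains to see that the hypergeometric
expressions satisfy it.

Put a = (alpha + 1) / 2, s = (alpha + beta + 2) / 2, theta = w / ((1 + c) a),
and let J_m = F(-m, m+s; a; z), K_m = F(-m, m+s+1; a+1; z).  The claimed
formulas read
<<
   p_(2m) = J_m + m theta K_(m-1),    p_(2m+1) = J_m - (m+s) theta K_m.
>>
The product w theta can be linearized, since (1 - x)^2 = 2 (1 - x) - (1 - x^2):
<<
   w theta = 2 theta - (1 - c) z / a.
>>
After this, for both parities of n, the difference equation follows from two
contiguous relations of Gauss' series, [hyp2F1_contiguousS] for J_(m+1) - J_m
and [hyp2F1_contiguous] for J_m in terms of K_m and K_(m-1).  Both relations
hold coefficient by coefficient for arbitrary parameters, so they are proved
on partial sums, which agree with the series when it terminates. *)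

(** * Gauss' series and its contiguous relations *)

Section Gauss.
Variable R : realType.
Implicit Types (a b c t z : R) (k m N : nat).

Lemma pochhammer0 t : pochhammer t 0 = 1.
Proof. exact: big_ord0. Qed.

Lemma pochhammerSr t k : pochhammer t k.+1 = pochhammer t k * (t + k%:R).
Proof. exact: big_ord_recr. Qed.

Lemma pochhammerSl t k : pochhammer t k.+1 = t * pochhammer (t + 1) k.
Proof.
rewrite /pochhammer big_ord_recl addr0; congr (_ * _).
by apply: eq_bigr => i _; rewrite /bump /= natrD addrA.
Qed.

Lemma pochhammer_shift t k :
  t * pochhammer (t + 1) k = pochhammer t k * (t + k%:R).
Proof. by rewrite -pochhammerSl pochhammerSr. Qed.

Lemma pochhammer_gt0 t k : 0 < t -> 0 < pochhammer t k.
Proof. by move=> t0; apply: prodr_gt0 => i _; rewrite ltr_wpDr. Qed.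

Lemma pochhammerN_eq0 m k : (m < k)%N -> pochhammer (- m%:R : R) k = 0.
Proof.
move=> mk; apply/eqP/prodf_eq0; exists (Ordinal mk) => //=.
by rewrite addrC subrr.
Qed.

Definition gauss_coef a b c k : R :=
  pochhammer a k * pochhammer b k / (pochhammer c k * k`!%:R).

Definition gauss_sum a b c z N : R := \sum_(k < N) gauss_coef a b c k * z ^+ k.

(** The partial sums are stationary from m + 1 on, because (-m)_k vanishes
for k > m. *)
Lemma hyp2F1_terminating m b c z N : (m < N)%N ->
  hyp2F1 (- m%:R) b c z = gauss_sum (- m%:R) b c z N.
Proof.
move=> mN; rewrite /hyp2F1; apply/(lim_near_cst (@Rhausdorff R)).
near=> M; have NM : (N <= M)%N by near: M; exact: nbhs_infty_ge.
rewrite /series /= (big_cat_nat (leq0n N) NM) /= -[RHS]addr0 big_mkord; congr (_ + _).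
apply: big1_seq => k /andP[_]; rewrite mem_index_iota => /andP[Nk _].
by rewrite pochhammerN_eq0 ?(leq_trans mN) // !mul0r.
Unshelve. all: by end_near. Qed.

(** By a (a+1)_k = (a)_k (a+k) and its analogues for b and c, the three
coefficients have a common factor; what is left is
(c-a)(b+k) - (c-b)(a+k) = (b-a)(c+k). *)
Lemma gauss_coef_contiguous a b c k : 0 < c ->
  b * (c - a) * gauss_coef a (b + 1) (c + 1) k
  - a * (c - b) * gauss_coef (a + 1) b (c + 1) k
  = c * (b - a) * gauss_coef a b c k.
Proof.
move=> c0; rewrite /gauss_coef.
have Z0 : pochhammer c k != 0 by rewrite gt_eqF ?pochhammer_gt0.
have c0' : c != 0 by rewrite gt_eqF.
have ck0 : c + k%:R != 0 by rewrite gt_eqF // ltr_wpDr.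
have f0 : (k`!%:R : R) != 0 by rewrite pnatr_eq0 -lt0n fact_gt0.
have -> : pochhammer (c + 1) k = pochhammer c k * (c + k%:R) / c.
  by rewrite -pochhammer_shift mulrC mulrA mulVf ?mul1r.
have Ea := pochhammer_shift a k; have Eb := pochhammer_shift b k.
move: Ea Eb Z0 f0 ck0.
move: (pochhammer a k) (pochhammer (a + 1) k) (pochhammer b k)
  (pochhammer (b + 1) k) (pochhammer c k) (k`!%:R : R) => X X' Y Y' Z f.
move: (k%:R : R) => q Ea Eb Z0 f0 ck0.
have -> : b * (c - a) * (X * Y' / (Z * (c + q) / c * f)) =
   (c - a) * (X * (b * Y') / (Z * (c + q) / c * f)) by ring.
have -> : a * (c - b) * (X' * Y / (Z * (c + q) / c * f)) =
   (c - b) * ((a * X') * Y / (Z * (c + q) / c * f)) by ring.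
by rewrite Ea Eb; field; rewrite c0' Z0 f0.
Qed.

(** The index shift reflects the factor z in [gauss_sum_contiguousS]: both
terms on the left are multiples of (a)_k (b+1)_k / ((c+1)_k k!). *)
Lemma gauss_coef_contiguousS a b c k : 0 < c ->
  gauss_coef (a - 1) (b + 1) c k.+1 - gauss_coef a b c k.+1
  = (a - b - 1) / c * gauss_coef a (b + 1) (c + 1) k.
Proof.
move=> c0; rewrite /gauss_coef.
have c0' : c != 0 by rewrite gt_eqF.
have Z0 : pochhammer (c + 1) k != 0 by rewrite gt_eqF ?pochhammer_gt0 ?addr_gt0.
have f0 : (k`!%:R : R) != 0 by rewrite pnatr_eq0 -lt0n fact_gt0.
have k0 : (k%:R + 1 : R) != 0 by rewrite gt_eqF // ltr_wpDl.
rewrite factS natrM -[k.+1%:R]natr1.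
rewrite (pochhammerSl (a - 1)) subrK (pochhammerSr (b + 1)) (pochhammerSr a).
rewrite (pochhammerSl b) (pochhammerSl c).
by field; rewrite c0' Z0 f0.
Qed.

Lemma gauss_sum_contiguous a b c z N : 0 < c ->
  b * (c - a) * gauss_sum a (b + 1) (c + 1) z N
  - a * (c - b) * gauss_sum (a + 1) b (c + 1) z N
  = c * (b - a) * gauss_sum a b c z N.
Proof.
move=> c0; rewrite /gauss_sum !mulr_sumr -sumrB; apply: eq_bigr => k _.
by rewrite [RHS]mulrA -gauss_coef_contiguous //; ring.
Qed.

(** The constant terms of the two sums on the left cancel, which leaves room
for the factor z and explains the different numbers of terms. *)
Lemma gauss_sum_contiguousS a b c z N : 0 < c ->
  gauss_sum (a - 1) (b + 1) c z N.+1 - gauss_sum a b c z N.+1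
  = (a - b - 1) / c * z * gauss_sum a (b + 1) (c + 1) z N.
Proof.
move=> c0; rewrite /gauss_sum -sumrB big_ord_recl /=.
rewrite {1 2}/gauss_coef !pochhammer0 subrr add0r mulr_sumr.
apply: eq_bigr => k _; rewrite -mulrBl gauss_coef_contiguousS // exprS.
ring.
Qed.

(** For m = 0 the predecessor is truncated, but the factor m kills that
term. *)
Lemma hyp2F1_contiguous m s c z : 0 < c ->
  (c + m%:R) * (m%:R + s) * hyp2F1 (- m%:R) (m%:R + s + 1) (c + 1) z
  + m%:R * (c - m%:R - s) *
      hyp2F1 (- m.-1%:R) (m.-1%:R + s + 1) (c + 1) z
  = c * (s + 2 * m%:R) * hyp2F1 (- m%:R) (m%:R + s) c z.
Proof.
move=> c0; have := @gauss_sum_contiguous (- m%:R) (m%:R + s) c z m.+1 c0.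
rewrite !(@hyp2F1_terminating m _ _ _ m.+1) //.
rewrite (@hyp2F1_terminating m.-1 _ _ _ m.+1); last by rewrite ltnS leq_pred.
case: m => [|m] /=; first by move=> E; lra.
rewrite -natr1.
have -> : - (m%:R + 1) + 1 = - m%:R :> R by ring.
have -> : m%:R + 1 + s = m%:R + s + 1 by ring.
by move=> E; lra.
Qed.

Lemma hyp2F1_contiguousS m s c z : 0 < c ->
  hyp2F1 (- m.+1%:R) (m.+1%:R + s) c z - hyp2F1 (- m%:R) (m%:R + s) c z
  = - ((2 * m%:R + 1 + s) / c * z *
       hyp2F1 (- m%:R) (m%:R + s + 1) (c + 1) z).
Proof.
move=> c0; have := @gauss_sum_contiguousS (- m%:R) (m%:R + s) c z m.+1 c0.
rewrite (@hyp2F1_terminating m.+1 _ _ _ m.+2) //.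
rewrite (@hyp2F1_terminating m _ c _ m.+2) //.
rewrite (@hyp2F1_terminating m _ (c + 1) _ m.+1) //.
by rewrite -natr1 (opprD _ 1) (addrAC _ s) => ->; ring.
Qed.

End Gauss.

(** * The recurrence normalized at x = 1 *)

Lemma natr_double (R : realType) m : m.*2%:R = 2 * m%:R :> R.
Proof. by rewrite -mul2n natrM. Qed.

Lemma natr_doubleS (R : realType) m : m.*2.+1%:R = 2 * m%:R + 1 :> R.
Proof. by rewrite -natr1 natr_double. Qed.

(** The recurrence for P_n turns into one for p_n = P_n / (A_0 ... A_(n-1)),
stated without that division.  The predecessor at n = 0 is multiplied by
C_0 = 0. *)
Lemma horner_bigm1_jacobi (R : realType) (alpha beta c : R) (x : R) (p : nat -> R) : p 0%N = 1 ->
  (forall n, jacobiA alpha beta c n * (p n.+1 - p n)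
    - jacobiC alpha beta c n * (p n - p n.-1) = - ((1 - x) * p n)) ->
  forall n, (bigm1_jacobi alpha beta c n).[x] =
    (\prod_(i < n) jacobiA alpha beta c i) * p n.
Proof.
move=> p0 rec n.
suff [//] : (bigm1_jacobi alpha beta c n).[x] =
    (\prod_(i < n) jacobiA alpha beta c i) * p n /\
   (bigm1_jacobi alpha beta c n.+1).[x] =
    (\prod_(i < n.+1) jacobiA alpha beta c i) * p n.+1.
elim: n => [|n [IH0 IH1]].
  rewrite big_ord1 big_ord0 /= !hornerE p0; split => //.
  have := rec 0%N; rewrite p0 /jacobi_u /jacobi_b /jacobiC /= mulr0 mul0r.
  by move=> E; lra.
split=> //.
have -> : bigm1_jacobi alpha beta c n.+2 =
    'X * bigm1_jacobi alpha beta c n.+1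
    - jacobi_b alpha beta c n.+1 *: bigm1_jacobi alpha beta c n.+1
    - jacobi_u alpha beta c n.+1 *: bigm1_jacobi alpha beta c n by [].
move: (bigm1_jacobi _ _ _ n.+1) (bigm1_jacobi _ _ _ n) IH1 IH0 => P1 P0 IH1 IH0.
rewrite !(hornerD, hornerN, hornerZ, hornerM, hornerX) IH0 IH1 !big_ord_recr /= /jacobi_b /jacobi_u /=.
have := rec n.+1 => /=.
move: (jacobiA alpha beta c n.+1) (jacobiC alpha beta c n.+1) (\prod_(i < n) _).
move: (jacobiA alpha beta c n) (p n) (p n.+1) (p n.+2) => A q0 q1 q2 A' C' Q E.
have -> : Q * A * A' * q2 =
  Q * A * (A' * (q2 - q1) - C' * (q1 - q0)) + Q * A * (A' * q1 + C' * (q1 - q0)) by ring.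
by rewrite E; ring.
Qed.

(** * The coefficients and the normalization by parity *)

Lemma jacobiA_even (R : realType) (alpha beta c : R) m :
  - 2 < alpha + beta ->
  jacobiA alpha beta c m.*2 =
  (1 + c) * ((alpha + 1) / 2 + m%:R) / ((alpha + beta + 2) / 2 + 2 * m%:R).
Proof.
rewrite /jacobiA odd_double natr_double.
move=> hab; move: (m%:R : R) (ler0n R m) => q q0; field; rewrite !gt_eqF //; lra.
Qed.

Lemma jacobiA_odd (R : realType) (alpha beta c : R) m :
  - 2 < alpha + beta ->
  jacobiA alpha beta c m.*2.+1 =
  (1 - c) * ((alpha + beta + 2) / 2 + m%:R)
  / ((alpha + beta + 2) / 2 + 2 * m%:R + 1).
Proof.
rewrite /jacobiA /= odd_double natr_doubleS /=.
move=> hab; move: (m%:R : R) (ler0n R m) => q q0; field; rewrite !gt_eqF //; lra.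
Qed.

Lemma jacobiC_odd (R : realType) (alpha beta c : R) m :
  - 2 < alpha + beta ->
  jacobiC alpha beta c m.*2.+1 =
  (1 + c) * ((alpha + beta + 2) / 2 - (alpha + 1) / 2 + m%:R)
  / ((alpha + beta + 2) / 2 + 2 * m%:R).
Proof.
rewrite /jacobiC /= odd_double natr_doubleS /=.
move=> hab; move: (m%:R : R) (ler0n R m) => q q0; field; rewrite !gt_eqF //; lra.
Qed.

Lemma jacobiC_even (R : realType) (alpha beta c : R) m :
  - 2 < alpha + beta ->
  jacobiC alpha beta c m.+1.*2 =
  (1 - c) * (m%:R + 1) / ((alpha + beta + 2) / 2 + 2 * m%:R + 1).
Proof.
rewrite /jacobiC odd_double natr_double -[m.+1%:R]natr1.
move=> hab; move: (m%:R : R) (ler0n R m) => q q0; field; rewrite !gt_eqF //; lra.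
Qed.

Lemma jacobi_kappa_even (R : realType) (alpha beta c : R) m : jacobi_kappa alpha beta c m.*2 =
  (1 - c ^+ 2) ^+ m * pochhammer ((alpha + 1) / 2) m
  / pochhammer ((alpha + beta + 2) / 2 + m%:R) m.
Proof.
rewrite /jacobi_kappa odd_double doubleK natr_double; congr (_ / pochhammer _ _).
by field.
Qed.

Lemma jacobi_kappa_odd (R : realType) (alpha beta c : R) m : jacobi_kappa alpha beta c m.*2.+1 =
  (1 + c) * ((1 - c ^+ 2) ^+ m * pochhammer ((alpha + 1) / 2) m.+1
  / pochhammer ((alpha + beta + 2) / 2 + m%:R) m.+1).
Proof.
rewrite /jacobi_kappa /= odd_double doubleK natr_doubleS.
congr (_ * (_ / pochhammer _ _)).
by field.
Qed.

(** For even n the ratio kappa_(n+1) / kappa_n is immediate.  From 2m+1 to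
2m+2 the base of the Pochhammer symbol in the denominator moves from s+m to
s+m+1, which [pochhammer_shift] undoes. *)
Lemma jacobi_kappaE (R : realType) (alpha beta c : R) n :
  - 2 < alpha + beta ->
  jacobi_kappa alpha beta c n = \prod_(i < n) jacobiA alpha beta c i.
Proof.
move=> hab; have pos m k : 0 < pochhammer ((alpha + beta + 2) / 2 + m%:R) k.
  by apply: pochhammer_gt0; rewrite ltr_wpDr // divr_gt0 //; lra.
have s0 : 0 < (alpha + beta + 2) / 2 by lra.
elim: n => [|n IH].
  by rewrite big_ord0 (jacobi_kappa_even _ _ _ _ 0) !pochhammer0 expr0 mulr1 divr1.
rewrite big_ord_recr /= -IH -[n]odd_double_half; case: (odd n) => /=; last first.
  rewrite add0n jacobi_kappa_even jacobi_kappa_odd jacobiA_even //.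
  move: n./2 (ler0n R n./2) => m m0; rewrite !pochhammerSr.
  have -> : (alpha + beta + 2) / 2 + m%:R + m%:R =
            (alpha + beta + 2) / 2 + 2 * m%:R by ring.
  have H : (alpha + beta + 2) / 2 + 2 * m%:R != 0 by rewrite gt_eqF //; lra.
  have H' := lt0r_neq0 (pos m m).
  move: H H'; move: ((alpha + beta + 2) / 2) ((alpha + 1) / 2) => s a H H'.
  by field; rewrite H H'.
rewrite add1n -doubleS jacobi_kappa_even jacobi_kappa_odd jacobiA_odd //.
move: n./2 (ler0n R n./2) => m m0.
have H : (alpha + beta + 2) / 2 + 2 * m%:R + 1 != 0 by rewrite gt_eqF //; lra.
have H1 : (alpha + beta + 2) / 2 + m%:R != 0 by rewrite gt_eqF //; lra.
have Z0 := lt0r_neq0 (pos m m.+1).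
have E := pochhammer_shift _ ((alpha + beta + 2) / 2 + m%:R) m.+1.
rewrite -[m.+1%:R]natr1 addrA exprS.
rewrite -[m.+1%:R]natr1 in E.
move: E Z0 H H1; move: ((alpha + beta + 2) / 2) ((alpha + 1) / 2) => s a.
move: (pochhammer a m.+1) (pochhammer (s + m%:R) m.+1)
  (pochhammer (s + m%:R + 1) m.+1) => X Z Y E Z0 H H1.
have -> : Y = Z * (s + 2 * m%:R + 1) / (s + m%:R).
  by apply: (mulfI H1); rewrite E; field.
by field; rewrite H H1 Z0.
Qed.

(** * The hypergeometric formula *)

Theorem mainTheorem3 (R : realType) (alpha beta c : R)
    (halpha : -1 < alpha) (hbeta : -1 < beta)
    (hc1 : c != 1) (hcN1 : c != -1) (n : nat) (x : R) :
  let z := (1 - x ^+ 2) / (1 - c ^+ 2) in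
  (~~ odd n ->
    (bigm1_jacobi alpha beta c n).[x] =
      jacobi_kappa alpha beta c n *
        (hyp2F1 (- (n%:R / 2)) ((n%:R + alpha + beta + 2) / 2)
                ((alpha + 1) / 2) z
         + n%:R * (1 - x) / ((1 + c) * (alpha + 1)) *
           hyp2F1 (1 - n%:R / 2) ((n%:R + alpha + beta + 2) / 2)
                  ((alpha + 3) / 2) z))
  /\
  (odd n ->
    (bigm1_jacobi alpha beta c n).[x] =
      jacobi_kappa alpha beta c n *
        (hyp2F1 (- ((n%:R - 1) / 2)) ((n%:R + alpha + beta + 1) / 2)
                ((alpha + 1) / 2) z
         - (alpha + beta + n%:R + 1) * (1 - x) / ((1 + c) * (alpha + 1)) *
           hyp2F1 (- ((n%:R - 1) / 2)) ((n%:R + alpha + beta + 3) / 2)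
                  ((alpha + 3) / 2) z)).
Proof.
move=> z.
set a := (alpha + 1) / 2; set s := (alpha + beta + 2) / 2.
have a0 : 0 < a by rewrite /a; lra.
have s0 : 0 < s by rewrite /s; lra.
have c1 : 1 + c != 0 by rewrite addrC addr_eq0.
have c1' : 1 - c != 0 by rewrite subr_eq0 eq_sym.
have a1 : alpha + 1 != 0 by rewrite gt_eqF //; lra.
have a0' := lt0r_neq0 a0.
pose J m := hyp2F1 (- m%:R) (m%:R + s) a z.
pose K m := hyp2F1 (- m%:R) (m%:R + s + 1) (a + 1) z.
pose th := (1 - x) / ((1 + c) * a).
pose p n := if odd n then J n./2 - (n./2%:R + s) * th * K n./2
  else J n./2 + n./2%:R * th * K n./2.-1.
have p_even m : p m.*2 = J m + m%:R * th * K m.-1.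
  by rewrite /p odd_double doubleK.
have p_odd m : p m.*2.+1 = J m - (m%:R + s) * th * K m.
  by rewrite /p /= odd_double uphalf_double.
(* The square of 1 - x is removed through (1-x)^2 = 2(1-x) - (1-c^2)z. *)
have wth : (1 - x) * th = 2 * th - (1 - c) * z / a.
  rewrite /th /z; field; rewrite a0' c1 /=.
  by rewrite (_ : 1 - c ^+ 2 = (1 - c) * (1 + c)); [rewrite mulf_neq0 | ring].
have wE : 1 - x = (1 + c) * a * th.
  by rewrite /th; field; rewrite c1 a0'.
have sm0 m : s + 2 * m%:R != 0 by rewrite gt_eqF // ltr_wpDr // mulr_ge0.
have sm1 m : s + 2 * m%:R + 1 != 0.
  by rewrite gt_eqF // ltr_wpDr // ltr_wpDr // mulr_ge0.
have JS m : J m.+1 = J m - (2 * m%:R + 1 + s) / a * z * K m.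
  by rewrite -(hyp2F1_contiguousS _ m s _ z a0) addrC subrK.
(* The form in which the second contiguous relation enters: theta absorbs
   w, so that x enters only through theta and z. *)
have wJ m : (1 - x) * J m = (1 + c) * th *
    (((a + m%:R) * (m%:R + s) * K m + m%:R * (a - m%:R - s) * K m.-1)
     / (s + 2 * m%:R)).
  by rewrite hyp2F1_contiguous // wE -/(J m); field; exact: sm0.
have hab : - 2 < alpha + beta by lra.
have horner_p : (bigm1_jacobi alpha beta c n).[x] =
    jacobi_kappa alpha beta c n * p n.
  rewrite jacobi_kappaE //; apply: horner_bigm1_jacobi => // [|k].
    rewrite (p_even 0%N) mul0r mul0r addr0 /J.
    rewrite (@hyp2F1_terminating _ 0%N _ _ _ 1%N) // /gauss_sum big_ord1.
    by rewrite /gauss_coef !pochhammer0 fact0 expr0 !mulr1 divr1.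
  rewrite -[k]odd_double_half; case: (odd k) => /=; move: k./2 => m.
    rewrite add1n -doubleS jacobiA_odd // jacobiC_odd // !p_even !p_odd /= -/s -/a.
    have wp : (1 - x) * (J m - (m%:R + s) * th * K m) =
      (1 - x) * J m - (m%:R + s) * ((1 - x) * th) * K m by ring.
    rewrite wp wJ wth JS -[m.+1%:R]natr1.
    by field; rewrite a0' sm0 sm1.
  rewrite add0n jacobiA_even // p_odd p_even -/s -/a.
  have wp : (1 - x) * (J m + m%:R * th * K m.-1) =
    (1 - x) * J m + m%:R * ((1 - x) * th) * K m.-1 by ring.
  rewrite wp wJ wth; case: m {wp} => [|m].
    (* Here C_0 = 0, and p_(-1) is replaced by p_0. *)
    have := sm0 0%N.
    rewrite /jacobiC /= !mulr0 !mul0r !(add0r, addr0, subr0) => s0'; field.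
    exact: s0'.
  rewrite jacobiC_even // doubleS /= p_odd JS -/s.
  have := sm1 m; have := sm0 m.+1; rewrite -[m.+1%:R]natr1 => H0 H1.
  by field; rewrite H0 H1 a0'.
split=> no; rewrite horner_p; congr (_ * _); rewrite -[n]odd_double_half.
  rewrite (negbTE no) add0n p_even natr_double /J /K /th.
  case: n./2 => [|m] /=.
    (* The second series does not terminate here, but its coefficient is 0. *)
    rewrite !(mul0r, mulr0, oppr0, addr0); congr hyp2F1.
    by rewrite /s; field.
  have -> : 1 - 2 * m.+1%:R / 2 = - m%:R :> R by rewrite -[m.+1%:R]natr1; field.
  have -> : - (2 * m.+1%:R / 2) = - m.+1%:R :> R by field.
  have -> : (2 * m.+1%:R + alpha + beta + 2) / 2 = m.+1%:R + s.
    by rewrite /s; field.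
  have -> : (alpha + 3) / 2 = a + 1 by rewrite /a; field.
  rewrite -[m.+1%:R]natr1 (addrAC _ 1).
  by congr (_ + _ * _); rewrite /a; field; rewrite a1 c1.
rewrite no add1n p_odd natr_doubleS /J /K /th.
move: n./2 => m.
have -> : - ((2 * m%:R + 1 - 1) / 2) = - m%:R :> R by field.
have -> : (2 * m%:R + 1 + alpha + beta + 1) / 2 = m%:R + s by rewrite /s; field.
have -> : (2 * m%:R + 1 + alpha + beta + 3) / 2 = m%:R + s + 1.
  by rewrite /s; field.
have -> : (alpha + 3) / 2 = a + 1 by rewrite /a; field.
by congr (_ - _ * _); rewrite /a /s; field; rewrite a1 c1.
Qed.
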